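(* Let $q$ be a power of a prime $p$, $m\ge 1$, and let $n=\widetilde n\cdot p^v$ with $v\ge 1$ and $\widetilde n$ coprime to $p$. Let $x^{\widetilde n}-1=\prod_{i=1}^{\nu} g_i(x)$ be the factorization into (pairwise distinct) monic irreducible polynomials in $\mathbb{F}_{q^m}[x]$, so that $x^n-1=\prod_{i=1}^{\nu}\big(g_i(x)\big)^{p^v}$. Let $C$ be an $[n,k]$ cyclic code over $\mathbb{F}_{q^m}$, $1\le k\le n-1$, whose generator polynomial is of the form $g(x)=\prod_{i\in J}\big(g_i(x)\big)^{p^{v_i}}$ with $J\subset\{1,\dots,\nu\}$ and integers $0\le v_i\le v$ for $i\in J$. Let $\widetilde g(x)=\prod_{i\in J}g_i(x)$, let $\widetilde k=\widetilde n-\sum_{i\in J}\deg g_i(x)$, and let $\widetilde C$ be the $[\widetilde n,\widetilde k]$ cyclic code over $\mathbb{F}_{q^m}$ with generator polynomial $\widetilde g(x)$. If $\eta_q(\widetilde C)\le\widetilde n-1$, then $C$ has rank weight $1$.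
   Context: An $[n,k]$ linear code over $\mathbb{F}_{q^m}$ is a $k$-dimensional $\mathbb{F}_{q^m}$-subspace $C$ of $\mathbb{F}_{q^m}^n$. It is cyclic with generator polynomial $g(x)$ (monic, dividing $x^n-1$, of degree $n-k$) if, identifying vectors with polynomials of degree $\le n-1$, $C$ is the ideal generated by $g(x)$ in $\mathbb{F}_{q^m}[x]/(x^n-1)$, i.e. $C=\{c(x)g(x) : c(x)\in\mathbb{F}_{q^m}[x],\ \deg c\le k-1\}$. The rank weight of a vector $c=(c_1,\dots,c_n)\in\mathbb{F}_{q^m}^n$ is the rank over $\mathbb{F}_q$ of the $m\times n$ matrix $\lambda(c)$ whose $i$-th column is the coordinate vector of $c_i$ in a fixed $\mathbb{F}_q$-basis of $\mathbb{F}_{q^m}$. The rank weight of a code $C$ is $d_1(\lambda(C))=\min_{c\in C,\,c\ne 0}\mathrm{rk}(\lambda(c))$. Definition of $\eta_q(\widetilde C)$ for a cyclic code $\widetilde C$ over $\mathbb{F}_{q^m}$ of length coprime to $q$ with generator polynomial $\widetilde g(x)$: let $m'$ be a multiple of $m$ such that $\widetilde g(x)$ splits in $\mathbb{F}_{q^{m'}}[x]$; its roots are simple. Partition the roots of $\widetilde g(x)$ into classes, two roots being in the same class if and only if they have the same minimal polynomial over $\mathbb{F}_q$, and choose one representative $\beta_1,\dots,\beta_s$ in each class. Then $\eta_q(\widetilde C)=\sum_{j=1}^{s}[\mathbb{F}_q(\beta_j):\mathbb{F}_q]$. *)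

(* Defs.v *)
From HB Require Import structures.
From mathcomp Require Import all_boot all_order all_algebra all_field.

Set Implicit Arguments.
Unset Strict Implicit.
Unset Printing Implicit Defensive.

Import GRing.Theory.
Local Open Scope ring_scope.

(* [n, k] code; [rVpoly c] is the polynomial \sum_(i < n) c_i 'X^i, so that     *)
(* [size a <= k] says deg a <= k - 1.                                         *)
Definition is_cyclic_code (L : fieldType) (n k : nat)
    (C : {vspace 'rV[L]_n}) (g : {poly L}) : Prop :=
  [/\ \dim C = k,
      g \is monic,
      g %| 'X^n - 1,
      (k <= n)%N /\ size g = (n - k).+1
    & forall c : 'rV[L]_n,
        c \in C <-> exists2 a : {poly L}, (size a <= k)%N & rVpoly c = a * g].

Definition lambda (F : fieldType) (L : fieldExtType F) (m n : nat)
    (b : m.-tuple L) (c : 'rV[L]_n) : 'M[F]_(m, n) :=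
  \matrix_(i < m, j < n) coord b i (c 0 j).

Definition has_rank_weight (F : fieldType) (L : fieldExtType F) (m n : nat)
    (b : m.-tuple L) (C : {vspace 'rV[L]_n}) (d : nat) : Prop :=
  (exists c : 'rV[L]_n, [/\ c \in C, c != 0 & \rank (lambda b c) = d]) /\
  (forall c : 'rV[L]_n, c \in C -> c != 0 -> (d <= \rank (lambda b c))%N).

(* [bs] lists exactly one element of each class of [rs] for the relation      *)
(* "same minimal polynomial over F" (1%VS is F seen inside M).                *)
Definition is_conj_reps (F : fieldType) (M : fieldExtType F) (rs bs : seq M) :
    Prop :=
  {subset bs <= rs} /\
  (forall z, z \in rs -> count (fun b => minPoly 1 b == minPoly 1 z) bs = 1%N).

(* The relation "eta_q(C) = e", q = #|F|.  The extension M of L (in which the *)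
(* generator polynomial splits, with list of roots [rs]) and the              *)
(* representatives [bs] may be chosen arbitrarily.                            *)
Definition is_eta (F : finFieldType) (L : fieldExtType F) (n k : nat)
    (C : {vspace 'rV[L]_n}) (e : nat) : Prop :=
  coprime n #|F| /\
  exists g : {poly L}, is_cyclic_code k C g /\
  exists (M : fieldExtType F) (iota : {lrmorphism L -> M}) (rs bs : seq M),
    [/\ map_poly iota g = \prod_(z <- rs) ('X - z%:P),
        is_conj_reps rs bs
      & e = (\sum_(b <- bs) \dim <<1; b>>)%N].

(* Main.v *)
(* The product h of the distinct minimal polynomials over F of the roots of the *)
(* generator polynomial of Ct has coefficients in F, degree eta, and is         *)
(* divisible by that generator polynomial.  Hence h^(p^v) is a multiple of g,   *)
(* and eta <= nt - 1 makes its degree smaller than n: it is a codeword of C     *)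
(* with entries in F, so of rank weight 1.                                      *)

Require Import Defs.
From HB Require Import structures.
From mathcomp Require Import all_boot all_order all_algebra all_field.

Set Implicit Arguments.
Unset Strict Implicit.
Unset Printing Implicit Defensive.

Import GRing.Theory.
Local Open Scope ring_scope.

(** Since [nt] is coprime to p, the roots of [gt] are simple, so [gt] divides any polynomial over F
    vanishing at them; the product [h] of one minimal polynomial per class is such a polynomial, of
    degree [e] ([eta_poly]). As [vi i <= v], g divides [gt ^+ (p ^ v)], hence [h ^+ (p ^ v)], whose
    degree [e * p ^ v] is below n: a nonzero codeword ([cyclic_code_mem]). Its entries lie in F, so
    its matrix is a column times a row, of rank 1 ([has_rank_weight1]). *)

(** Needed because [is_eta] quantifies over a generator of its own, which must be identified with
    [gt]. Both generators are monic of the same size, so one divisibility suffices. *)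
Lemma cyclic_code_gen_uniq (L : fieldType) (n k : nat)
    (C : {vspace 'rV[L]_n}) (g g' : {poly L}) :
  is_cyclic_code k C g -> is_cyclic_code k C g' -> g = g'.
Proof.
case=> _ g_mon g_dvd [le_kn size_g] Cg [_ g'_mon g'_dvd [_ size_g'] Cg'].
have size_gg' : size g' == size g by rewrite size_g size_g'.
suff g'g : g' %| g.
  apply/esym/eqP; rewrite -eqp_monic //.
  by rewrite -(dvdp_size_eqp g'g).
(* If k > 0, g is itself a codeword, hence a multiple of [g']. If k = 0, the size n + 1 forces g to
   be associate to ['X^n - 1]. *)
have [k0|k_gt0] := posnP k; last first.
  have size_g_le : (size g <= n)%N.
    by rewrite size_g ltn_subrL k_gt0 (leq_trans k_gt0 le_kn).
  have /Cg' [a _ aE] : poly_rV g \in C.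
    by apply/Cg; exists 1; rewrite ?size_poly1 // mul1r poly_rV_K.
  by rewrite -(poly_rV_K size_g_le) aE dvdp_mull.
move: size_g size_g'; rewrite k0 subn0 => size_g size_g'.
(* For n = 0 the polynomial ['X^n - 1] vanishes, but then [g'] has size 1 and is a unit. *)
have [n0|n_gt0] := posnP n.
  apply: (@dvdp_trans _ 1); last exact: dvd1p.
  by rewrite dvdp1 size_g' n0.
have /eqp_dvdr -> // : g %= 'X^n - 1.
by rewrite -(dvdp_size_eqp g_dvd) size_g size_XnsubC.
Qed.

Lemma rank_lambda_gt0 (F : fieldType) (L : fieldExtType F) (m n : nat)
    (b : m.-tuple L) (c : 'rV[L]_n) :
  basis_of {:L} b -> c != 0 -> (0 < \rank (lambda b c))%N.
Proof.
move=> b_basis; apply: contraR; rewrite -eqn0Ngt mxrank_eq0 => /eqP lam0.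
apply/eqP/rowP=> j; rewrite mxE (coord_basis b_basis (memvf (c 0 j))).
by apply: big1 => i _; have /matrixP/(_ i j) := lam0; rewrite !mxE => ->; rewrite scale0r.
Qed.

(** Each column is a scalar of F times the coordinate column of 1, so the matrix is an outer
    product. *)
Lemma rank_lambda_in_alg (F : fieldType) (L : fieldExtType F) (m n : nat)
    (b : m.-tuple L) (c : 'rV[F]_n) :
  (\rank (lambda b (map_mx (in_alg L) c)) <= 1)%N.
Proof.
suff -> : lambda b (map_mx (in_alg L) c) = (\col_i coord b i 1) *m c.
  exact: mulmx_max_rank.
by apply/matrixP=> i j; rewrite !mxE big_ord1 !mxE /= linearZ /= mulrC.
Qed.

Lemma has_rank_weight1 (F : fieldType) (L : fieldExtType F) (m n : nat)
    (b : m.-tuple L) (C : {vspace 'rV[L]_n}) (c : 'rV[F]_n) :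
  basis_of {:L} b -> c != 0 -> map_mx (in_alg L) c \in C ->
  has_rank_weight b C 1.
Proof.
move=> b_basis c_neq0 cC; split=> [|d _ d_neq0]; last exact: rank_lambda_gt0.
have c'_neq0 : map_mx (in_alg L) c != 0 by rewrite map_mx_eq0.
exists (map_mx (in_alg L) c); split=> //.
by apply/eqP; rewrite eqn_leq rank_lambda_in_alg rank_lambda_gt0.
Qed.

Lemma cyclic_code_mem (L : fieldType) (n k : nat) (C : {vspace 'rV[L]_n})
    (g f : {poly L}) :
  is_cyclic_code k C g -> f != 0 -> (size f <= n)%N -> g %| f ->
  poly_rV f \in C.
Proof.
case=> _ _ _ [le_kn size_g] Cg f_neq0 size_f /dvdpP [a fE].
apply/Cg; exists a; last by rewrite poly_rV_K.
move: f_neq0 size_f; rewrite fE mulf_eq0 negb_or => /andP [a0 g0].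
by rewrite size_mul // size_g addnS /= addnBA // leq_subLR leq_add2r.
Qed.

(** As the roots are distinct, it is enough that each z in [rs] is a root of the right-hand product;
    the representative of its class contributes the minimal polynomial of z. *)
Lemma conj_reps_dvd (F : fieldType) (M : fieldExtType F) (rs bs : seq M) :
  uniq rs -> is_conj_reps rs bs ->
  \prod_(z <- rs) ('X - z%:P) %| \prod_(b <- bs) minPoly 1 b.
Proof.
move=> rs_uniq [_ reps]; apply: uniq_roots_dvdp; last by rewrite uniq_rootsE.
apply/allP=> z /reps count1.
have /hasP [b b_bs /eqP bz] : has (fun b => minPoly 1 b == minPoly 1 z) bs.
  by rewrite has_count count1.
by rewrite (big_rem b) //= rootM bz (root_minPoly 1%AS).
Qed.

(** Minimal polynomials over [1%VS] have coefficients in F, and their degrees are the dimensions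
    summed in eta. *)
Lemma prod_minPoly1_descent (F : fieldType) (M : fieldExtType F) (bs : seq M) :
  exists h : {poly F},
    [/\ h \is monic, size h = (\sum_(b <- bs) \dim <<1; b>>).+1
      & map_poly (in_alg M) h = \prod_(b <- bs) minPoly 1 b].
Proof.
elim: bs => [|b bs [h [h_mon size_h hE]]].
  by exists 1; rewrite !big_nil monic1 size_poly1 rmorph1.
have /polyOver1P [f fE] := minPolyOver 1%AS b.
have f_mon : f \is monic by rewrite -(map_monic (in_alg M)) -fE monic_minPoly.
exists (f * h); split; first by rewrite monicMl.
- rewrite size_Mmonic ?monic_neq0 // size_h big_cons.
  rewrite -(size_map_poly (in_alg M) f) -fE size_minPoly.
  by rewrite (adjoin_degreeE 1%AS) dimv1 divn1 addnS.
- by rewrite rmorphM big_cons -hE fE.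
Qed.

Lemma pchar_natr_neq0 (F : fieldType) (M : fieldExtType F) (p n : nat) :
  p \in [pchar F] -> coprime n p -> n%:R != 0 :> M.
Proof.
move=> charFp; have charMp : p \in [pchar M] by rewrite pchar_lalg.
rewrite -(dvdn_pcharf charMp) coprime_sym prime_coprime //.
exact: pcharf_prime charFp.
Qed.

Lemma eta_poly (F : finFieldType) (L : fieldExtType F) (p r n k e : nat)
    (C : {vspace 'rV[L]_n}) (g : {poly L}) :
  prime p -> #|F| = (p ^ r)%N -> coprime n p ->
  is_cyclic_code k C g -> is_eta k C e ->
  exists h : {poly F},
    [/\ h \is monic, size h = e.+1 & g %| map_poly (in_alg L) h].
Proof.
move=> p_prime cardF n_p Cg [_ [g' [Cg' [M [iota [rs [bs [g'E reps ->]]]]]]]].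
rewrite (cyclic_code_gen_uniq Cg Cg').
have [h [h_mon size_h hE]] := prod_minPoly1_descent bs.
exists h; split=> //; rewrite -(dvdp_map iota) -map_poly_comp.
(* The two embeddings of F into M, directly and through L, agree because [iota] is F-linear. *)
rewrite (eq_map_poly (g := in_alg M)); last first.
  by move=> x; rewrite /= linearZ /= rmorph1.
rewrite hE g'E; apply: conj_reps_dvd => //.
(* The roots are distinct because the generator divides ['X^n - 1], which is separable when n is
   nonzero in M. *)
rewrite -separable_prod_XsubC -g'E.
have [_ _ g'_dvd _ _] := Cg'.
apply: (@dvdp_separable _ ('X^n - 1)).
  by rewrite -(dvdp_map iota) rmorphB rmorph1 /= map_polyXn in g'_dvd.
apply: separable_Xn_sub_1.
by apply: pchar_natr_neq0 n_p; apply: card_finPcharP cardF p_prime.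
Qed.

Theorem proposition4
  (p r q m v nt n k kt nu e : nat)
  (F : finFieldType) (L : fieldExtType F)
  (b : m.-tuple L)
  (gi : 'I_nu -> {poly L}) (J : {set 'I_nu}) (vi : 'I_nu -> nat)
  (g gt : {poly L})
  (C : {vspace 'rV[L]_n}) (Ct : {vspace 'rV[L]_nt})
  (p_prime : prime p) (r_gt0 : (0 < r)%N) (qE : q = (p ^ r)%N)
  (cardF : #|F| = q)
  (m_ge1 : (1 <= m)%N) (dimL : \dim {:L} = m)
  (b_basis : basis_of {:L} b)
  (v_ge1 : (1 <= v)%N) (nt_coprime : coprime nt p) (nE : n = (nt * p ^ v)%N)
  (gi_monic : forall i, gi i \is monic)
  (gi_irr : forall i, irreducible_poly (gi i))
  (gi_inj : injective gi)
  (gi_prod : 'X^nt - 1 = \prod_(i < nu) gi i)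
  (k_bounds : (1 <= k <= n - 1)%N)
  (vi_le : forall i, i \in J -> (vi i <= v)%N)
  (gE : g = \prod_(i in J) gi i ^+ (p ^ vi i)%N)
  (C_cyclic : is_cyclic_code k C g)
  (gtE : gt = \prod_(i in J) gi i)
  (ktE : kt = (nt - \sum_(i in J) (size (gi i)).-1)%N)
  (Ct_cyclic : is_cyclic_code kt Ct gt)
  (eta_Ct : is_eta kt Ct e)
  (eta_le : (e <= nt - 1)%N) :
  has_rank_weight b C 1.
Proof.
have [h [h_mon size_h gt_dvd]] : exists h : {poly F},
    [/\ h \is monic, size h = e.+1 & gt %| map_poly (in_alg L) h].
  by apply: eta_poly p_prime _ nt_coprime Ct_cyclic eta_Ct; rewrite cardF qE.
(* With truncated subtraction, [e <= nt - 1] means [e < nt] only for positive [nt]; the bounds on k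
   exclude n = 0. *)
have nt_gt0 : (0 < nt)%N.
  by rewrite lt0n; apply: contraL k_bounds => /eqP nt0; rewrite nE nt0 mul0n; case: (k).
pose f := h ^+ (p ^ v).
have f_mon : f \is monic by rewrite monic_exp.
have pv_gt0 : (0 < p ^ v)%N by rewrite expn_gt0 prime_gt0.
have size_f : (size f <= n)%N.
  have sf0 : (0 < size f)%N by rewrite size_poly_gt0 monic_neq0.
  rewrite -(prednK sf0) size_exp size_h nE ltn_pmul2r //=.
  by rewrite -(prednK nt_gt0) -subn1 ltnS.
have g_dvd : g %| map_poly (in_alg L) f.
  rewrite rmorphXn /=; apply: dvdp_trans (dvdp_exp2r _ gt_dvd).
  (* Factor by factor, g divides [gt ^+ (p ^ v)], since [p ^ vi i <= p ^ v]. *)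
  rewrite gE gtE -prodrXl; apply: (big_ind2 (fun x y => x %| y)) => [||i iJ].
  - exact: dvdpp.
  - by move=> *; apply: dvdp_mul.
  - by rewrite dvdp_exp2l // leq_pexp2l ?prime_gt0 ?vi_le.
apply: (has_rank_weight1 (c := poly_rV f) b_basis).
  apply: contra_neq (monic_neq0 f_mon) => f0.
  by rewrite -(poly_rV_K size_f) f0 linear0.
suff -> : map_mx (in_alg L) (poly_rV f) = poly_rV (map_poly (in_alg L) f) :> 'rV_n.
  apply: (cyclic_code_mem C_cyclic) => //; last by rewrite size_map_poly.
  by rewrite map_poly_eq0 monic_neq0.
by apply/rowP=> j; rewrite !mxE coef_map.
Qed.
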